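(* Let $r$ be a real number and $A,B\subseteq\omega$. Then $A\oplus B$ has intrinsic density $r$ if and only if both $A$ and $B$ have intrinsic density $r$.
   Context: $A\oplus B=\{2n:n\in A\}\cup\{2n+1:n\in B\}$. For $S\subseteq\omega$, $\rho_n(S)=|S\cap\{0,\dots,n-1\}|/n$ and $\rho(S)=\lim_n\rho_n(S)$ when it exists. $S$ has intrinsic density $r$ (written $P(S)=r$) if $\rho(\pi(S))=r$ for every computable permutation $\pi$ of $\omega$. *)

(* Defs.v *)
From mathcomp Require Import all_boot all_order all_algebra.
From mathcomp Require Import all_classical all_reals all_analysis.

Set Implicit Arguments.
Unset Strict Implicit.
Unset Printing Implicit Defensive.

Import Order.TTheory GRing.Theory Num.Theory.
Import numFieldNormedType.Exports.

Local Open Scope classical_set_scope.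

(* Kleene's partial recursive functions: [recf n] is the type of programs of
   arity n. *)
Inductive recf : nat -> Type :=
| RZero : recf 0
| RSucc : recf 1
| RProj n (i : 'I_n) : recf n
| RComp m n (f : recf m) (gs : 'I_m -> recf n) : recf n
| RPrec n (f : recf n) (g : recf n.+2) : recf n.+1
| RMu n (f : recf n.+1) : recf n.

(* Given the graphs of f and g, the graph of h at fixed parameters v, where
   h 0 v = f v and h k.+1 v = g k (h k v) v. *)
Fixpoint prec_graph n (F : n.-tuple nat -> nat -> Prop)
    (G : n.+2.-tuple nat -> nat -> Prop) (v : n.-tuple nat) (k y : nat) : Prop :=
  match k with
  | 0 => F v y
  | k'.+1 => exists2 z, prec_graph F G v k' z & G [tuple of k' :: z :: v] y
  end.

(* [reval e v y]: the program e on input v halts with output y. In the RMu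
   case all values below the least zero are required to be defined. *)
Fixpoint reval n (e : recf n) : n.-tuple nat -> nat -> Prop :=
  match e in recf n return n.-tuple nat -> nat -> Prop with
  | RZero => fun _ y => y = 0
  | RSucc => fun v y => y = (thead v).+1
  | RProj _ i => fun v y => y = tnth v i
  | RComp m _ f gs => fun v y =>
      exists2 w : m.-tuple nat,
        forall i, reval (gs i) v (tnth w i) & reval f w y
  | RPrec _ f g => fun v y =>
      prec_graph (reval f) (reval g) [tuple of behead v] (thead v) y
  | RMu _ f => fun v y =>
      reval f [tuple of y :: v] 0 /\
      forall k, k < y -> exists z, reval f [tuple of k :: v] z.+1
  end.

Definition computable (f : nat -> nat) : Prop :=
  exists e : recf 1, forall x, reval e [tuple x] (f x).

Definition computable_permutation (p : nat -> nat) : Prop :=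
  computable p /\ bijective p.

Definition set_oplus (A B : set nat) : set nat :=
  [set 2 * n | n in A] `|` [set 2 * n + 1 | n in B].

Local Open Scope ring_scope.

Definition partial_density (R : realType) (S : set nat) (n : nat) : R :=
  #|[set k : 'I_n | (k : nat) \in S]%SET|%:R / n%:R.

Definition has_density (R : realType) (S : set nat) (r : R) : Prop :=
  partial_density R S n @[n --> \oo] --> r.

Definition has_intrinsic_density (R : realType) (S : set nat) (r : R) : Prop :=
  forall p : nat -> nat, computable_permutation p -> has_density (p @` S) r.

(* Main.v *)
(* If A and B have intrinsic density r and p is a computable permutation, let
   H be the computable set p(evens).  Replacing p(2n) by its rank in H turns
   n |-> p(2n) into a computable permutation, so p(2A) has density r relative
   to H; likewise p(2B+1) has density r relative to the complement of H, and
   the two parts add up to density r.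

   Conversely, given a computable permutation q and d > 0, let p send the odd
   numbers onto the multiples of d+1, and 2n to the q(n)-th non-multiple of
   d+1.  Up to an error of O(1/d) the partial densities of q(A) are those of
   p(A (+) B), which tend to r; letting d grow gives the density of q(A).  The
   case of B follows by swapping 2n and 2n+1. *)

Require Import Defs.
From mathcomp Require Import all_boot all_order all_algebra.
From mathcomp Require Import all_classical all_reals all_analysis.
From mathcomp Require Import zify lra.

Set Implicit Arguments.
Unset Strict Implicit.
Unset Printing Implicit Defensive.

Import Order.TTheory GRing.Theory Num.Theory.
Import numFieldNormedType.Exports.

Local Open Scope classical_set_scope.

(** * Closure properties of the computable functions *)

(** [F] takes untyped sequences, constrained only at length [n], so that arguments can be read off
    with [nth 0] and no dependent lengths appear. *)
Definition recursive n (F : seq nat -> nat) : Prop :=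
  exists e : recf n, forall v : n.-tuple nat, reval e v (F v).

Definition recursive1 (f : nat -> nat) : Prop :=
  recursive 1 (fun v => f (nth 0 v 0)).

Definition recursive2 (f : nat -> nat -> nat) : Prop :=
  recursive 2 (fun v => f (nth 0 v 0) (nth 0 v 1)).

Lemma recursive1P f : recursive1 f <-> computable f.
Proof.
split=> -[e He]; exists e; first by move=> x; exact: (He [tuple x]).
move=> v.
suff -> : v = [tuple nth 0 v 0] by exact: He.
by apply: val_inj; case: v => [[|x []]].
Qed.

Lemma recursive_ext n (F G : seq nat -> nat) :
  (forall v, size v = n -> F v = G v) -> recursive n F -> recursive n G.
Proof.
move=> FG [e He]; exists e => v.
by rewrite -FG ?size_tuple//; exact: He.
Qed.

Lemma recursive_nth n i : i < n -> recursive n (fun v => nth 0 v i).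
Proof. by move=> lt_in; exists (RProj (Ordinal lt_in)) => v /=; rewrite (tnth_nth 0). Qed.

Lemma recursive_comp1 n f G :
  recursive1 f -> recursive n G -> recursive n (fun v => f (G v)).
Proof.
move=> [e He] [e1 He1]; exists (RComp e (fun=> e1)) => v /=.
exists [tuple G v]; last exact: (He [tuple G v]).
by case=> [[|//] ?]; rewrite (tnth_nth 0) /=.
Qed.

Lemma recursive_comp2 n f G H :
  recursive2 f -> recursive n G -> recursive n H ->
  recursive n (fun v => f (G v) (H v)).
Proof.
move=> [e He] [e1 He1] [e2 He2].
exists (RComp e (fun i => if i == ord0 then e1 else e2)) => v /=.
exists [tuple G v; H v]; last exact: (He [tuple G v; H v]).
by case=> [[|[|//]] ?]; rewrite (tnth_nth 0) /=.
Qed.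

Lemma recursive_succ : recursive1 succn.
Proof. by exists RSucc => v /=; rewrite /thead (tnth_nth 0). Qed.

Lemma recursive_const n c : recursive n (fun=> c).
Proof.
elim: c => [|c /(recursive_comp1 recursive_succ)//].
have gs (i : 'I_0) : recf n by case: i.
by exists (RComp RZero gs) => v /=; exists [tuple] => // -[].
Qed.

(** [H] enters through its recursion equations, so that functions already defined elsewhere can be
    shown recursive without being rebuilt. *)
Lemma recursive_prec n (F G : seq nat -> nat) (H : nat -> seq nat -> nat) :
  recursive n F -> recursive n.+2 G ->
  (forall v, H 0 v = F v) ->
  (forall k v, H k.+1 v = G [:: k, H k v & v]) ->
  recursive n.+1 (fun v => H (head 0 v) (behead v)).
Proof.
move=> [e He] [e' He'] H0 HS; exists (RPrec e e') => v /=.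
rewrite /thead (tnth_nth 0) nth0; elim: (head 0 v) => [|k IH] /=.
  by rewrite H0; exact: (He [tuple of behead v]).
exists (H k (behead v)) => //.
by rewrite HS; exact: (He' [tuple of [:: k, H k (behead v) & behead v]]).
Qed.

Lemma recursive_prec1 c (g : nat -> nat -> nat) (h : nat -> nat) :
  recursive2 g -> h 0 = c -> (forall k, h k.+1 = g k (h k)) -> recursive1 h.
Proof.
move=> rg h0 hS.
have := @recursive_prec 0 (fun=> c) (fun v => g (nth 0 v 0) (nth 0 v 1))
  (fun k _ => h k) (recursive_const 0 c) rg (fun=> h0) (fun k _ => hS k).
by apply: recursive_ext => v _; rewrite nth0.
Qed.

Lemma recursive_prec2 (f : nat -> nat) G (h : nat -> nat -> nat) :
  recursive1 f -> recursive 3 G -> (forall x, h 0 x = f x) ->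
  (forall k x, h k.+1 x = G [:: k; h k x; x]) -> recursive2 h.
Proof.
move=> rf rG h0 hS.
have rG' : recursive 3 (fun v => G [:: nth 0 v 0; nth 0 v 1; nth 0 v 2]).
  by apply: recursive_ext rG => -[|x [|y [|z []]]].
have := @recursive_prec 1 (fun v => f (nth 0 v 0))
  (fun v => G [:: nth 0 v 0; nth 0 v 1; nth 0 v 2])
  (fun k v => h k (nth 0 v 0)) rf rG' (fun v => h0 _) (fun k v => hS k _).
by apply: recursive_ext => -[|x []].
Qed.

Lemma recursive_mu (f : nat -> nat -> nat) (h : nat -> nat) :
  recursive2 f -> (forall x, f (h x) x = 0) ->
  (forall x k, k < h x -> 0 < f k x) -> recursive1 h.
Proof.
move=> [e He] f0 fpos; exists (RMu e) => v /=; split.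
  by have := He [tuple of h (nth 0 v 0) :: v]; rewrite /= f0.
move=> k /fpos fk; exists (f k (nth 0 v 0)).-1.
by rewrite prednK//; exact: (He [tuple of k :: v]).
Qed.

Lemma recursive2C f : recursive2 f -> recursive2 (fun x y => f y x).
Proof. by move=> rf; apply: (recursive_comp2 rf); apply: recursive_nth. Qed.

Lemma recursive_add : recursive2 addn.
Proof.
apply: (@recursive_prec2 id (fun v => (nth 0 v 1).+1)) => //.
- exact: recursive_nth.
- exact/(recursive_comp1 recursive_succ)/recursive_nth.
Qed.

Lemma recursive_mul : recursive2 muln.
Proof.
apply: (@recursive_prec2 (fun=> 0) (fun v => nth 0 v 2 + nth 0 v 1)) => //.
- exact: recursive_const.
- by apply: (recursive_comp2 recursive_add); exact: recursive_nth.
Qed.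

Lemma recursive_pred : recursive1 predn.
Proof. by apply: (@recursive_prec1 0 (fun k _ => k)) => //; exact: recursive_nth. Qed.

Lemma recursive_sub : recursive2 subn.
Proof.
(* Truncated subtraction recurses on the subtrahend, so the arguments are swapped first. *)
apply/(@recursive2C (fun x y => y - x))/(@recursive_prec2 id (fun v => (nth 0 v 1).-1)) => /=.
- exact: recursive_nth.
- exact/(recursive_comp1 recursive_pred)/recursive_nth.
- exact: subn0.
- by move=> k x; rewrite subnS.
Qed.

Lemma recursive_odd : recursive1 (fun n => odd n : nat).
Proof.
apply: (@recursive_prec1 0 (fun _ y => 1 - y)) => [|//|k /=]; last by case: odd.
apply: (recursive_comp2 recursive_sub); first exact: recursive_const.
exact: recursive_nth.
Qed.

(** The quotient is the least [k] with [n < k.+1 * d], that is, the least zero of a truncated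
    difference. *)
Lemma recursive_divn d : 0 < d -> recursive1 (fun n => n %/ d).
Proof.
move=> d0; apply: (@recursive_mu (fun k n => n.+1 - k.+1 * d)).
- apply: (recursive_comp2 recursive_sub).
    exact/(recursive_comp1 recursive_succ)/recursive_nth.
  apply: (recursive_comp2 recursive_mul); last exact: recursive_const.
  exact/(recursive_comp1 recursive_succ)/recursive_nth.
- by move=> x; have := ltn_ceil x d0; lia.
- by move=> x k; rewrite leq_divRL//; lia.
Qed.

Lemma recursive_if n (b : seq nat -> bool) F G :
  recursive n (fun v => b v) -> recursive n F -> recursive n G ->
  recursive n (fun v => if b v then F v else G v).
Proof.
move=> rb rF rG.
apply: (@recursive_ext _ (fun v => b v * F v + (1 - b v) * G v)) => [v _|].
  by case: (b v); rewrite ?mul1n ?mul0n ?addn0.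
apply: (recursive_comp2 recursive_add); apply: (recursive_comp2 recursive_mul) => //.
by apply: (recursive_comp2 recursive_sub) => //; exact: recursive_const.
Qed.

(** Unbounded search for the preimage; the sum of the two truncated differences is the distance from
    [f k] to [x]. *)
Lemma recursive_inverse (f g : nat -> nat) :
  recursive1 f -> cancel f g -> cancel g f -> recursive1 g.
Proof.
move=> rf fK gK.
apply: (@recursive_mu (fun k x => (f k - x) + (x - f k))).
- apply: (recursive_comp2 recursive_add); apply: (recursive_comp2 recursive_sub);
    by [exact: recursive_nth | exact/(recursive_comp1 rf)/recursive_nth].
- by move=> x; rewrite gK; lia.
- move=> x k kg; have : f k <> x by move=> E; rewrite -E fK ltnn in kg.
  by lia.
Qed.

(** * Counting *)

Definition count_below (S : set nat) n : nat := \sum_(k < n) ((k : nat) \in S : nat).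

Lemma count_belowS S n : count_below S n.+1 = count_below S n + (n \in S).
Proof. by rewrite /count_below big_ord_recr. Qed.

Lemma count_below_le S m n : m <= n ->
  count_below S m <= count_below S n <= count_below S m + (n - m).
Proof.
elim: n => [|n IH]; first by rewrite leqn0 => /eqP->; rewrite subnn addn0 leqnn.
rewrite leq_eqVlt ltnS => /predU1P[->|mn]; first by rewrite subnn addn0 !leqnn.
by have := IH mn; rewrite count_belowS; case: (n \in S) => /=; lia.
Qed.

Lemma recursive_count_below S :
  recursive1 (fun n => n \in S : nat) -> recursive1 (count_below S).
Proof.
move=> rS; apply: (@recursive_prec1 0 (fun k y => y + (k \in S))).
- apply: (recursive_comp2 recursive_add); first exact: recursive_nth.
  exact/(recursive_comp1 rS)/recursive_nth.
- exact: big_ord0.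
- by move=> k; rewrite count_belowS.
Qed.

Lemma injective_unbounded (f : nat -> nat) :
  injective f -> forall N, exists i, N <= f i.
Proof.
move=> inj_f N; apply: contrapT => /forallNP bnd.
have ltN i : f i < N by rewrite ltnNge; apply/negP/bnd.
(* Pigeonhole: a bound [N] would inject [N.+1] points into [N]. *)
pose F (i : 'I_N.+1) : 'I_N := Ordinal (ltN i).
have : injective F by move=> i j /(congr1 val)/inj_f /val_inj.
by move/leq_card; rewrite !card_ord ltnn.
Qed.

Lemma count_below_range_unbounded (f : nat -> nat) :
  injective f -> forall m, exists N, forall n, N <= n -> m <= count_below (range f) n.
Proof.
move=> inj_f; elim=> [|m [N IH]]; first by exists 0.
have [i Nfi] := injective_unbounded inj_f N; exists (f i).+1 => n fin.
have /andP[+ _] := count_below_le (range f) fin.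
rewrite count_belowS mem_set; last by exists i.
by have := IH _ Nfi; lia.
Qed.

(** * Ranks within the range of an injection *)

Section Compression.
Variable f : nat -> nat.
Hypothesis inj_f : injective f.

(** The rank of [f n] in the range of [f], counted from zero. *)
Definition compress n := count_below (range f) (f n).

Lemma count_below_lt_range i n : f i < n -> compress i < count_below (range f) n.
Proof.
move=> fin; have /andP[+ _] := count_below_le (range f) fin.
by rewrite count_belowS mem_set ?addn1//; exists i.
Qed.

Lemma compress_inj : injective compress.
Proof.
move=> i j E; apply: inj_f.
by case: (ltngtP (f i) (f j)) => // /count_below_lt_range; rewrite -/(compress _) E ltnn.
Qed.

Lemma compress_surj m : exists i, compress i = m.
Proof.
have ex : exists n, m < count_below (range f) n.
  by have [N HN] := count_below_range_unbounded inj_f m.+1; exists N; apply: HN.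
(* The least bound with more than [m] range elements below it is a successor [n.+1], and [n] is then
   the range element of rank [m]. *)
case: (ex_minnP ex) => -[|n]; first by rewrite /count_below big_ord0.
rewrite count_belowS => lt_m min_n.
have le_m : count_below (range f) n <= m.
  by rewrite leqNgt; apply/negP => /min_n; rewrite ltnn.
case: (boolP (n \in range f)) lt_m le_m => [/set_mem [i _ <-]|_] /=; last by lia.
by move=> lt_m le_m; exists i; rewrite /compress; lia.
Qed.

Lemma compress_bij : bijective compress.
Proof.
have [g gK] := choice compress_surj.
by exists g => // i; apply: compress_inj; rewrite gK.
Qed.

(** Ranking preserves order on the range, so counts of [f @]
    A[relative to the range of]f[become ordinary counts of]compress @[A]. *)
Lemma count_below_image A n :
  count_below (f @` A) n = count_below (compress @` A) (count_below (range f) n).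
Proof.
elim: n => [|n IH]; first by rewrite /count_below !big_ord0.
rewrite !count_belowS IH.
case: (boolP (n \in range f)) => [/set_mem [i _ <-]|nH] /=; last first.
  rewrite addn0 memNset ?addn0// => -[i _ fi].
  by move/negP: nH; apply; rewrite inE; exists i.
rewrite addn1 count_belowS -/(compress i); congr (_ + nat_of_bool _).
by apply/idP/idP => /set_mem [j Aj] => [/inj_f|/compress_inj] <-;
  apply/mem_set; exists j.
Qed.

End Compression.

(** * Membership in images and in the two halves of a join *)

Lemma mem_image_can (p pinv : nat -> nat) (S : set nat) n :
  cancel p pinv -> cancel pinv p -> (n \in p @` S) = (pinv n \in S).
Proof.
move=> pK pinvK; apply/idP/idP => /set_mem; first by case=> k Sk <-; rewrite pK mem_set.
by move=> Sn; apply/mem_set; exists (pinv n).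
Qed.

Lemma mem_set_oplus A B k :
  (k \in set_oplus A B) = if odd k then k./2 \in B else k./2 \in A.
Proof.
have doubleE n : (2 * n)./2 = n /\ (2 * n + 1)./2 = n by lia.
apply/idP/idP => [/set_mem [[n An <-]|[n Bn <-]]|].
- by rewrite oddM /= (doubleE n).1 mem_set.
- by rewrite oddD oddM /= (doubleE n).2 mem_set.
- case: ifP => ok /set_mem AB; apply/mem_set; [right|left]; exists k./2 => //; lia.
Qed.

Lemma recursive_half : recursive1 half.
Proof. by apply: recursive_ext (recursive_divn (isT : 0 < 2)) => v _; rewrite divn2. Qed.

(** Treating the even half as a join with the empty set lets [mem_set_oplus] decide membership in
    it. *)
Lemma image_even (p : nat -> nat) A :
  (fun n => p (2 * n)) @` A = p @` set_oplus A set0.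
Proof. by rewrite /set_oplus image_set0 setU0 image_comp. Qed.

Lemma image_odd (p : nat -> nat) B :
  (fun n => p (2 * n + 1)) @` B = p @` set_oplus set0 B.
Proof. by rewrite /set_oplus image_set0 set0U image_comp. Qed.

Lemma recursive_double : recursive1 (muln 2).
Proof.
by apply: (recursive_comp2 recursive_mul); [exact: recursive_const|exact: recursive_nth].
Qed.

(** * Stretching *)

(* Enumerates in increasing order the numbers that are not multiples of [d.+1]. *)
Definition stretch d n := n + n %/ d + 1.

(** If [n = a * d + b] with [b < d], then [stretch d n = a * d.+1 + b.+1] with [b.+1 < d.+1]. *)
Lemma stretch_div d n : 0 < d -> stretch d n %/ d.+1 = n %/ d.
Proof.
move=> d0; have lt := ltn_pmod n d0.
rewrite /stretch {1}(divn_eq n d).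
have -> : n %/ d * d + n %% d + n %/ d + 1 = n %/ d * d.+1 + (n %% d).+1 by lia.
by rewrite divnMDl// (divn_small (lt : (n %% d).+1 < d.+1)) addn0.
Qed.

Lemma stretch_mod d n : 0 < d -> stretch d n %% d.+1 = (n %% d).+1.
Proof.
move=> d0; have lt := ltn_pmod n d0.
rewrite /stretch {1}(divn_eq n d).
have -> : n %/ d * d + n %% d + n %/ d + 1 = n %/ d * d.+1 + (n %% d).+1 by lia.
by rewrite modnMDl (modn_small (lt : (n %% d).+1 < d.+1)).
Qed.

(** There are [(y %/ d.+1).+1] multiples of [d.+1] up to [y], zero included; removing them leaves
    the rank of [y] among the non-multiples. *)
Lemma stretch_compl d y : 0 < d -> ~~ (d.+1 %| y) ->
  stretch d (y - (y %/ d.+1).+1) = y.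
Proof.
move=> d0; rewrite /dvdn; have := ltn_pmod y (ltn0Sn d); have := divn_eq y d.+1.
move: (y %/ d.+1) (y %% d.+1) => a [//|b] -> lt _.
have -> : a * d.+1 + b.+1 - a.+1 = a * d + b by lia.
by rewrite /stretch divnMDl// divn_small; lia.
Qed.

Definition spread d (q : nat -> nat) k :=
  if odd k then d.+1 * k./2 else stretch d (q k./2).

Lemma spread_computable_permutation d q : 0 < d ->
  computable_permutation q -> computable_permutation (spread d q).
Proof.
move=> d0 [/recursive1P rq [q' qK q'K]]; split.
  have rh := recursive_comp1 recursive_half (recursive_nth (isT : 0 < 1)).
  apply/recursive1P/recursive_if.
  - exact/(recursive_comp1 recursive_odd)/recursive_nth.
  - by apply: (recursive_comp2 recursive_mul) => //; exact: recursive_const.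
  - have rqh := recursive_comp1 rq rh.
    apply: (recursive_comp2 recursive_add); last exact: recursive_const.
    apply: (recursive_comp2 recursive_add) => //.
    exact: (recursive_comp1 (recursive_divn d0)).
(* Divisibility by [d.+1] tells which parity the preimage has. *)
exists (fun y => if d.+1 %| y then 2 * (y %/ d.+1) + 1
                 else 2 * q' (y - (y %/ d.+1).+1)) => [k|y].
  rewrite /spread; case: (boolP (odd k)) => ok; first by rewrite dvdn_mulr// mulKn//; lia.
  rewrite /dvdn stretch_mod//= stretch_div// /stretch.
  by have -> : q k./2 + q k./2 %/ d + 1 - (q k./2 %/ d).+1 = q k./2 by [lia]; rewrite qK; lia.
rewrite /spread; case: (boolP (d.+1 %| y)) => dy.
  have -> : odd (2 * (y %/ d.+1) + 1) by lia.
  have -> : (2 * (y %/ d.+1) + 1)./2 = y %/ d.+1 by lia.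
  by rewrite mulnC divnK.
set z := q' _; have -> : odd (2 * z) = false by lia.
by have -> : (2 * z)./2 = z by [lia]; rewrite q'K stretch_compl.
Qed.

(** Of the numbers below [g m], the [m] values [g i] with [i < m] contribute [count_below T m]; each
    of the other [g m - m] contributes at most one. *)
Lemma count_below_increasing (S T : set nat) (g : nat -> nat) m :
  {homo g : i j / i < j} -> (forall n, (g n \in S) = (n \in T)) ->
  count_below T m <= count_below S (g m) <= count_below T m + (g m - m).
Proof.
move=> gmono gST.
have ge n : n <= g n by elim: n => // n IH; exact: leq_ltn_trans IH (gmono _ _ (ltnSn n)).
elim: m => [|m IH].
  by have := count_below_le S (leq0n (g 0)); rewrite /count_below !big_ord0.
have := count_below_le S (gmono _ _ (ltnSn m)).
rewrite !count_belowS gST; have := gmono _ _ (ltnSn m); have := ge m.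
by lia.
Qed.

(** * Intrinsic density *)

Section Density.
Local Open Scope ring_scope.
Variable R : realType.
Implicit Types (r : R) (S A B : set nat).

Lemma partial_densityE S n :
  partial_density R S n = (count_below S n)%:R / n%:R.
Proof.
congr (_%:R / _); rewrite -sum1dep_card /count_below big_mkcond /=.
by apply: eq_bigr => k _; case: (_ \in S).
Qed.

(** Clearing the denominator turns densities into additive estimates on counts. *)
Lemma has_densityP S r : has_density S r <->
  forall e : R, 0 < e -> exists N, forall n, (N <= n)%N ->
    `|(count_below S n)%:R - r * n%:R| <= e * n%:R.
Proof.
have E n : (0 < n)%N -> `|r - partial_density R S n| * n%:R =
    `|(count_below S n)%:R - r * n%:R|.
  move=> n0; have nR : n%:R != 0 :> R by rewrite pnatr_eq0 -lt0n.
  rewrite partial_densityE -[X in _ * X]ger0_norm// -normrM.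
  by rewrite mulrBl divfK// distrC.
split=> [/cvgrPdist_le cvgS e e0|HS].
  (* The successor ensures [n > 0], so that multiplying by [n] cancels the division. *)
  have [N _ HN] := cvgS e e0; exists N.+1 => n Nn.
  by rewrite -E; [rewrite ler_wpM2r// HN//= ltnW|lia].
apply/cvgrPdist_le => e e0; have [N HN] := HS e e0; exists N.+1 => // n /= Nn.
by rewrite -(@ler_pM2r _ n%:R) ?E ?HN ?ltr0n//; lia.
Qed.

(** Decidability of the range makes [compress f] a computable permutation. The density of its image
    of [A] is evaluated at [count_below (range f) n], which tends to infinity with [n]. *)
Lemma has_intrinsic_density_image A r (f : nat -> nat) :
  has_intrinsic_density A r -> computable f -> injective f ->
  computable (fun n => n \in range f) ->
  forall e : R, 0 < e -> exists N, forall n, (N <= n)%N ->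
    `|(count_below (f @` A) n)%:R - r * (count_below (range f) n)%:R|
    <= e * (count_below (range f) n)%:R.
Proof.
move=> dA /recursive1P rf inj_f /recursive1P rH e e0.
have cp : computable_permutation (compress f).
  split; last exact: compress_bij.
  apply/recursive1P/(recursive_comp1 (recursive_count_below rH)).
  exact/(recursive_comp1 rf)/recursive_nth.
have [m Hm] := (has_densityP _ _).1 (dA _ cp) e e0.
have [N HN] := count_below_range_unbounded inj_f m.
by exists N => n /HN /Hm; rewrite (count_below_image inj_f A).
Qed.

Lemma has_intrinsic_density_oplus A B r :
  has_intrinsic_density A r -> has_intrinsic_density B r ->
  has_intrinsic_density (set_oplus A B) r.
Proof.
move=> dA dB p [/recursive1P rp [p' pK p'K]].
have inj_p := can_inj pK.
have rp' := recursive_inverse rp pK p'K.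
pose f0 n := p (2 * n)%N; pose f1 n := p (2 * n + 1)%N.
have f0E C n : (n \in f0 @` C) = if odd (p' n) then false else (p' n)./2 \in C.
  by rewrite image_even (mem_image_can _ _ pK p'K) mem_set_oplus in_set0.
have f1E C n : (n \in f1 @` C) = if odd (p' n) then (p' n)./2 \in C else false.
  by rewrite image_odd (mem_image_can _ _ pK p'K) mem_set_oplus in_set0.
(* The parity of [p' n] decides whether [n] lies in the range of [f0] or of [f1]; the inverse [p']
   is computable by search. *)
have rodd : recursive1 (fun n => odd (p' n) : nat).
  exact/(recursive_comp1 recursive_odd)/(recursive_comp1 rp')/recursive_nth.
have splitE n : count_below (p @` set_oplus A B) n =
    (count_below (f0 @` A) n + count_below (f1 @` B) n)%N.
  rewrite /count_below -big_split; apply: eq_bigr => k _ /=.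
  rewrite f0E f1E (mem_image_can _ _ pK p'K) mem_set_oplus.
  by case: odd; rewrite ?addn0.
have rangeE n : n = (count_below (range f0) n + count_below (range f1) n)%N.
  rewrite /count_below -big_split -[LHS]card_ord -sum1_card.
  by apply: eq_bigr => k _ /=; rewrite f0E f1E in_setT; case: odd.
apply/has_densityP => e e0.
have [N0 H0] : exists N, forall n, (N <= n)%N ->
    `|(count_below (f0 @` A) n)%:R - r * (count_below (range f0) n)%:R|
    <= e * (count_below (range f0) n)%:R.
  apply: has_intrinsic_density_image => //.
  - exact/recursive1P/(recursive_comp1 rp)/(recursive_comp1 recursive_double)/recursive_nth.
  - by move=> i j /inj_p; lia.
  - apply/recursive1P; apply: (@recursive_ext _ (fun v => 1 - odd (p' (nth 0 v 0)))%N).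
      by move=> v _; rewrite f0E in_setT; case: odd.
    by apply: (recursive_comp2 recursive_sub) => //; exact: recursive_const.
have [N1 H1] : exists N, forall n, (N <= n)%N ->
    `|(count_below (f1 @` B) n)%:R - r * (count_below (range f1) n)%:R|
    <= e * (count_below (range f1) n)%:R.
  apply: has_intrinsic_density_image => //.
  - apply/recursive1P/(recursive_comp1 rp)/(recursive_comp2 recursive_add).
      exact/(recursive_comp1 recursive_double)/recursive_nth.
    exact: recursive_const.
  - by move=> i j /inj_p; lia.
  - apply/recursive1P; apply: recursive_ext rodd => v _.
    by rewrite f1E in_setT; case: odd.
exists (maxn N0 N1) => n; rewrite geq_max => /andP[/H0 h0 /H1 h1].
(* The two range counts add up to [n], so the errors, each [e] times a range count, add up to
   exactly [e * n]. *)
rewrite splitE [in X in r * X](rangeE n) [in X in e * X](rangeE n) !natrD !mulrDr opprD addrACA.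
exact: le_trans (ler_normD _ _) (lerD h0 h1).
Qed.

Lemma has_intrinsic_density_oplus_left A B r :
  has_intrinsic_density (set_oplus A B) r -> has_intrinsic_density A r.
Proof.
move=> dAB q cq; apply/has_densityP => e e0.
(* With [t = stretch d m - m], passing from [stretch d m] to [m] changes the count by at most [t]
   and [r] times the length by [|r| * t]: at most [c * t] in all. *)
pose c : R := `|r| + 1.
have c0 : 0 < c by rewrite ltr_wpDl.
(* For [m >= d], [t = m %/ d + 1] is at most [2 * m / d], so this choice of [d] gives
   [c * t <= e * m / 2]. *)
have [d d0 hd] : exists2 d, (0 < d)%N & 4 * c <= e * d%:R.
  exists (Num.truncn (4 * c / e)).+1 => //.
  by rewrite -ler_pdivrMl// mulrC ltW// truncnS_gt.
have csp := spread_computable_permutation d0 cq.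
(* Since [t <= 2 * m], tolerance [e / 8] at length [m + t] costs at most [3 * e * m / 8]; with the
   previous [e * m / 2] this stays below [e * m]. *)
have e8 : 0 < e / 8 by rewrite divr_gt0.
have [N HN] := (has_densityP _ _).1 (dAB _ csp) _ e8.
have stretch_ge n : (n <= stretch d n)%N by rewrite /stretch -addnA leq_addr.
exists (maxn N d) => m; rewrite geq_max => /andP[Nm dm].
have := HN _ (leq_trans Nm (stretch_ge m)).
have : (count_below (q @` A) m <= count_below (spread d q @` set_oplus A B) (stretch d m)
   <= count_below (q @` A) m + (stretch d m - m))%N.
  apply: count_below_increasing => [i j ij|n].
    by have := leq_div2r d (ltnW ij); rewrite /stretch; lia.
  have [_ [q' qK q'K]] := cq; have [_ [s sK s'K]] := csp.
  (* The [n]-th non-multiple of [d.+1] is the image of [2 * q' n], so it lies in the image of the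
     join exactly when [q' n] is in [A]. *)
  have -> : stretch d n = spread d q (2 * q' n).
    by rewrite /spread oddM /= mul2n doubleK q'K.
  rewrite (mem_image_can _ _ sK s'K) sK mem_set_oplus oddM /= mul2n doubleK.
  by rewrite (mem_image_can _ _ qK q'K).
have -> : (stretch d m - m = m %/ d + 1)%N by rewrite /stretch -addnA addKn.
have : (m %/ d + 1)%:R * d%:R <= 2 * m%:R :> R.
  by rewrite -!natrM ler_nat; have := leq_trunc_div m d; lia.
have t_le : (m %/ d + 1)%:R <= 2 * m%:R :> R.
  by rewrite -natrM ler_nat; have := leq_div m d; lia.
move: (count_below (q @` A) m) (count_below _ (stretch _ _)) => x y.
rewrite /stretch -addnA; move: (m %/ d + 1)%N t_le => t t_le td.
move=> /andP[]; rewrite -!(ler_nat R) natrD => xy yx.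
have ct : 2 * (c * t%:R) <= e * m%:R.
  have : 4 * c * t%:R <= e * (2 * m%:R).
    apply: le_trans (_ : e * d%:R * t%:R <= _); first by rewrite ler_wpM2r.
    by rewrite -mulrA; apply: ler_wpM2l; [exact: ltW|rewrite mulrC].
  lra.
have et : e * t%:R <= e * (2 * m%:R) by rewrite ler_wpM2l ?(ltW e0).
have : `|r * t%:R| <= c * t%:R - t%:R.
  by rewrite normrM (ger0_norm (ler0n _ _)) /c mulrDl mul1r addrK.
rewrite natrD !ler_norml => /andP[rt1 rt2] /andP[].
rewrite !mulrDr => h1 h2; apply/andP; split; lra.
Qed.

(** The swap [s] carries one join to the other, and [p \o s] is again a computable permutation. *)
Lemma has_intrinsic_density_oplusC A B r :
  has_intrinsic_density (set_oplus A B) r -> has_intrinsic_density (set_oplus B A) r.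
Proof.
pose s k := if odd k then k.-1 else k.+1.
have sK : involutive s by move=> k; rewrite /s; case: (boolP (odd k)) => ok; case: ifP; lia.
have rs : recursive1 s.
  have r0 := recursive_nth (isT : 0 < 1)%N.
  exact: (recursive_if (recursive_comp1 recursive_odd r0)
    (recursive_comp1 recursive_pred r0) (recursive_comp1 recursive_succ r0)).
move=> dAB p [/recursive1P rp bij_p].
have <- : (p \o s) @` set_oplus A B = p @` set_oplus B A.
  rewrite -image_comp; congr (_ @` _); apply/funext => k.
  rewrite -[LHS]in_setE -[RHS]in_setE (mem_image_can _ _ sK sK) !mem_set_oplus /s.
  case: (boolP (odd k)) => ok; last by rewrite /= ok uphalf_half (negbTE ok).
  have -> : odd k.-1 = false by lia.
  by have -> : k.-1./2 = k./2 by lia.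
apply: dAB; split; last exact: bij_comp bij_p (inv_bij sK).
exact/recursive1P/(recursive_comp1 rp)/(recursive_comp1 rs)/recursive_nth.
Qed.

End Density.

Theorem theorem2p1 (R : realType) (r : R) (A B : set nat) :
  has_intrinsic_density (set_oplus A B) r <->
  has_intrinsic_density A r /\ has_intrinsic_density B r.
Proof.
split=> [dAB|[dA dB]]; last exact: has_intrinsic_density_oplus.
split; first exact: has_intrinsic_density_oplus_left dAB.
exact: has_intrinsic_density_oplus_left (has_intrinsic_density_oplusC dAB).
Qed.
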